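(* Let $G$ be a finite abelian group. For any positive odd integer $n$, $$\operatorname{aw}_u(G \times \mathbb{Z}_n, 3) = \operatorname{aw}_u(G,3) + \operatorname{aw}_u(\mathbb{Z}_n,3) - 2.$$
   Context: $\mathbb{Z}_n$ is the cyclic group $\{0,\dots,n-1\}$ under addition mod $n$. A $k$-term arithmetic progression ($k$-AP) in an abelian group $H$ is a sequence $a, a+d, \dots, a+(k-1)d$ with $a,d \in H$ (degenerate ones allowed). An $r$-coloring of $H$ is a function $c: H \to \{1,\dots,r\}$; it is exact if surjective. A $k$-AP is rainbow under $c$ if $c(a+id) \neq c(a+jd)$ for all $0 \le i < j \le k-1$. A coloring is unitary if some element of $H$ receives a color used on no other element. $\operatorname{aw}_u(H,k)$ is the smallest $r$ such that every exact unitary $r$-coloring of $H$ contains a rainbow $k$-AP; if $H$ has no $k$-AP, $\operatorname{aw}_u(H,k)=|H|+1$. *)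

(* Defs.v *)
From HB Require Import structures.
From mathcomp Require Import all_boot all_order all_fingroup all_algebra.

Set Implicit Arguments.
Unset Strict Implicit.
Unset Printing Implicit Defensive.

Import GRing.Theory.
Local Open Scope ring_scope.

Section AntiVanDerWaerden.

Variable H : finZmodType.

Definition rainbow (C : eqType) (c : H -> C) (k : nat) (a d : H) : bool :=
  [forall i : 'I_k, forall j : 'I_k,
     (i < j)%N ==> (c (a + d *+ i) != c (a + d *+ j))].

Definition contains_rainbow (C : eqType) (c : H -> C) (k : nat) : bool :=
  [exists a : H, exists d : H, rainbow c k a d].

(* A k-AP with k distinct terms is a k-AP that is rainbow for the identity
   coloring. *)
Definition has_AP (k : nat) : bool := contains_rainbow (@id H) k.

(* The colors {1, .., r} are represented by 'I_r. *)
Definition exact (r : nat) (c : {ffun H -> 'I_r}) : bool :=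
  [forall i : 'I_r, exists x : H, c x == i].

Definition unitary (r : nat) (c : {ffun H -> 'I_r}) : bool :=
  [exists x : H, forall y : H, (c y == c x) ==> (y == x)].

(* The first conjunct discards the r for which H has no exact unitary
   r-coloring: r = 0, r > #|H|, and r = 1 when #|H| > 1.  Without it r = 0 or
   r = 1 would vacuously be the smallest r. *)
Definition forces_rainbow (k r : nat) : bool :=
  [exists c : {ffun H -> 'I_r}, exact c && unitary c] &&
  [forall c : {ffun H -> 'I_r},
     exact c && unitary c ==> contains_rainbow c k].

Lemma forces_rainbow_card k : has_AP k -> forces_rainbow k #|H|.
Proof.
move=> /existsP[a /existsP[d AP]]; apply/andP; split.
  apply/existsP; exists [ffun x => enum_rank x]; apply/andP; split.
    by apply/forallP => i; apply/existsP; exists (enum_val i); rewrite ffunE enum_valK.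
  apply/existsP; exists 0; apply/forallP => y; apply/implyP.
  by rewrite !ffunE (inj_eq enum_rank_inj).
apply/forallP => c; apply/implyP => /andP[/forallP c_exact _].
have c_inj : injective c.
  apply/injectiveP/card_uniqP; rewrite size_map -cardE.
  rewrite -[RHS]card_ord; apply/eq_card => i.
  by have /existsP[x /eqP <-] := c_exact i; rewrite map_f // mem_enum.
apply/existsP; exists a; apply/existsP; exists d.
apply/forallP => i; apply/forallP => j; apply/implyP => lt_ij.
rewrite (inj_eq c_inj).
exact: (implyP (forallP (forallP AP i) j) lt_ij).
Qed.

Definition aw_u_candidate (k r : nat) : bool :=
  if has_AP k then forces_rainbow k r else r == #|H|.+1.

Lemma ex_aw_u_candidate k : exists r, aw_u_candidate k r.
Proof.
rewrite /aw_u_candidate; case AP: (has_AP k).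
  by exists #|H|; apply: forces_rainbow_card.
by exists #|H|.+1.
Qed.

Definition aw_u (k : nat) : nat := ex_minn (ex_aw_u_candidate k).

End AntiVanDerWaerden.

(* The library declares the Finite and Zmodule structures of a product, but not
   their join. *)
HB.instance Definition _ (G K : finZmodType) := GRing.Zmodule.on (G * K)%type.

(* Main.v *)
Require Import Defs.
From HB Require Import structures.
From mathcomp Require Import all_boot all_order all_fingroup all_algebra.
From mathcomp Require Import zify.

(** Since colors other than the unique one can be merged, [aw_u H 3] is one more
    than the largest number of colors of a unitary coloring of [H] without
    rainbow 3-AP.  Write [K] for the cyclic group of odd order.

    Lower bound: color the fibre of [G * K] over the uniquely colored element of
    [K] by an extremal coloring of [G], and the other fibres by an extremal
    coloring of [K].

    Upper bound: translate so that [0] has the unique color in a coloring [c] of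
    [G * K].  Then [c] is invariant under negation, and under doubling away from
    the elements of order 2.  If two colors [b != b'] absent from [G * 0] occurred
    at [(g, i)] and [(h, i)], then [(h + h - (g + g), 0)], [(h, i)],
    [(g + g, i + i)] would be a rainbow 3-AP, so each fibre carries at most one
    color absent from [G * 0].  Coloring [K] by these colors, with one color for
    [0] and one for the other fibres without new color, gives a unitary coloring
    without rainbow 3-AP. *)

Set Implicit Arguments.
Unset Strict Implicit.
Unset Printing Implicit Defensive.

Import GRing.Theory.
Local Open Scope ring_scope.

(** * Colorings without rainbow 3-AP *)

(** A 3-AP is given by the equation of its terms, with difference [y - x], so it can be read from
    either end. *)
Definition rainbow_free (H : zmodType) (C : Type) (c : H -> C) : Prop :=
  forall x y z, x + z = y + y -> c x = c y \/ c y = c z \/ c x = c z.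

Definition uniquely_colored (H C : Type) (c : H -> C) (x0 : H) : Prop :=
  forall y, c y = c x0 -> y = x0.

Definition free_colorable (H : finZmodType) (r : nat) : Prop :=
  exists c : {ffun H -> 'I_r},
    [/\ exact c, exists x0, uniquely_colored c x0 & rainbow_free c].

Lemma rainbow_freeP (H : finZmodType) (C : eqType) (c : H -> C) :
  reflect (rainbow_free c) (~~ contains_rainbow c 3).
Proof.
apply: (iffP idP) => [noR x y z xz|free].
  case: (c x =P c y) => [|/eqP nxy]; first by left.
  case: (c y =P c z) => [|/eqP nyz]; first by right; left.
  case: (c x =P c z) => [|/eqP nxz]; first by right; right.
  case/negP: noR; apply/existsP; exists x; apply/existsP; exists (y - x).
  have e1 : x + (y - x) = y by rewrite addrC subrK.
  have e2 : x + (y - x) *+ 2 = z.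
    by rewrite mulr2n addrA e1 addrA -xz addrAC subrr add0r.
  apply/forallP => -[[|[|[|//]]] /= ?]; apply/forallP => -[[|[|[|//]]] /= ?];
    by rewrite ?mulr0n ?mulr1n ?addr0 ?e1 ?e2.
apply/negP => /existsP[a /existsP[d /forallP R]].
have Rij (i j : 'I_3) : (i < j)%N -> c (a + d *+ i) != c (a + d *+ j).
  by move=> ij; move/forallP/(_ j)/implyP: (R i); apply.
have := Rij (inord 0) (inord 1); have := Rij (inord 1) (inord 2).
have := Rij (inord 0) (inord 2); rewrite !inordK //.
move=> /(_ isT) n02 /(_ isT) n12 /(_ isT) n01.
case: (free (a + d *+ 0) (a + d *+ 1) (a + d *+ 2)).
- by rewrite mulr0n addr0 mulr1n mulr2n !addrA [a + d + a]addrAC.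
- by move/eqP; apply/negP.
by case=> /eqP; apply/negP.
Qed.

Lemma unitaryP (H : finZmodType) (r : nat) (c : {ffun H -> 'I_r}) :
  reflect (exists x0, uniquely_colored c x0) (unitary c).
Proof.
apply: (iffP existsP) => -[x0 H0]; exists x0.
  by move=> y /eqP cy; move/forallP/(_ y)/implyP/(_ cy)/eqP: H0.
by apply/forallP => y; apply/implyP => /eqP /H0 ->.
Qed.

Lemma exact_leq_card (H : finZmodType) (r : nat) (c : {ffun H -> 'I_r}) :
  exact c -> (r <= #|H|)%N.
Proof.
move=> /forallP ex; rewrite -[r in (r <= _)%N]card_ord -cardsT.
have -> : [set: 'I_r] = c @: [set: H].
  apply/setP => i; rewrite inE; apply/esym/imsetP.
  by have /existsP[x /eqP <-] := ex i; exists x.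
by rewrite -cardsT leq_imset_card.
Qed.

(** * The number [aw_u H 3] as an extremal number of colors *)

(** Swap the unique color with [0], then merge all colors from [m - 1] on. As [1 < m], the class of
    [0] stays a singleton, and merging creates no rainbow. *)
Lemma merge_colors (H : finZmodType) (r m : nat) (c : {ffun H -> 'I_r}) :
  exact c -> unitary c -> (1 < m <= r)%N ->
  exists c' : {ffun H -> 'I_m},
    [/\ exact c', unitary c' & rainbow_free c -> rainbow_free c'].
Proof.
move=> /forallP ex /unitaryP[x0 u0] /andP[].
case: m => [//|m]; case: r => [|r] in c ex u0 *; first by [].
rewrite !ltnS => m_gt0 mr.
pose s : {perm 'I_r.+1} := tperm (c x0) ord0.
pose c' : {ffun H -> 'I_m.+1} := [ffun x => inord (minn (s (c x)) m)].
have c'E x : c' x = minn (s (c x)) m :> nat.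
  by rewrite ffunE inordK // ltnS geq_minr.
exists c'; split.
- apply/forallP => i; have im : (i <= m)%N by rewrite -ltnS.
  have /existsP[x /eqP cx] := ex (s (inord i)).
  apply/existsP; exists x; apply/eqP/val_inj; rewrite /= c'E cx tpermK.
  by rewrite inordK ?(leq_ltn_trans im) ?ltnS //; apply/minn_idPl.
- apply/unitaryP; exists x0 => y /(congr1 val) /=.
  rewrite !c'E tpermL min0n => min0; apply: u0; apply: (@perm_inj _ s).
  rewrite tpermL; apply/val_inj => /=; move: min0; rewrite /minn.
  by case: ifP => // _ m0; rewrite m0 in m_gt0.
move=> free x y z /free E; rewrite !ffunE.
by case: E => [->|[->|->]]; [left|right; left|right; right].
Qed.

(** Relabels the colors that occur, so that bounds on [aw_u] become bounds on cardinalities of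
    images. *)
Lemma free_colorable_image (H : finZmodType) (C : finType) (f : H -> C) x0 :
  uniquely_colored f x0 -> rainbow_free f ->
  free_colorable H #|[set f x | x : H]|.
Proof.
move=> u0 free.
have fA x : f x \in [set f x | x : H] by apply: imset_f.
pose c : {ffun H -> 'I_(#|[set f x | x : H]|)} :=
  [ffun x => enum_rank_in (fA x0) (f x)].
have c_eq x y : (c x = c y) <-> (f x = f y).
  rewrite !ffunE; split=> [|-> //].
  exact: (enum_rank_in_inj (fA x) (fA y)).
exists c; split.
- apply/forallP => i; have /imsetP[x _ fx] := enum_valP i.
  apply/existsP; exists x; apply/eqP.
  by rewrite ffunE -fx enum_valK_in.
- by exists x0 => y /c_eq /u0.
by move=> x y z /free; rewrite -!c_eq.
Qed.

Lemma free_colorable_lt_aw_u (H : finZmodType) (r : nat) :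
  free_colorable H r -> (r < aw_u H 3)%N.
Proof.
case=> c [ex /unitaryP u free]; rewrite /aw_u.
case: ex_minnP => m; rewrite /aw_u_candidate.
case: ifP => _ mP _; last by rewrite (eqP mP) ltnS (exact_leq_card ex).
case/andP: mP => /existsP[d /andP[dex dun]] /forallP all_m.
rewrite ltnNge; apply/negP => mr.
case: (ltnP 1 m) => [m_gt1|m_le1].
  have [|c' [ex' u' free']] := merge_colors (m := m) ex u; first by rewrite m_gt1.
  have := all_m c'; rewrite ex' u' /= => R.
  by have /rainbow_freeP := free' free; rewrite R.
(* With at most one color nothing is rainbow, so the witness [d] of nonvacuity contradicts
   forcing. *)
have := all_m d; rewrite dex dun /=; apply/negP/rainbow_freeP => x y z _; left.
apply/val_inj => /=; case: m d m_le1 {all_m mr dex dun} => [|[|//]] d _.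
  by case: (d x).
by rewrite !ord1.
Qed.

(** By minimality [m - 1] does not force a rainbow. Merging shows that exact unitary colorings with
    [m - 1] colors exist, so one of them is rainbow-free. If there is no 3-AP, the identity coloring
    serves. *)
Lemma free_colorable_aw_u (H : finZmodType) : free_colorable H (aw_u H 3).-1.
Proof.
rewrite /aw_u; case: ex_minnP => m; rewrite /aw_u_candidate.
case AP: (has_AP H 3) => mP m_min.
  case/andP: mP => /existsP[d /andP[dex dun]] /forallP all_m.
  have := all_m d; rewrite dex dun /= => /existsP[a /existsP[e R]].
  (* A rainbow 3-AP shows three colors; merging down to [m - 1] needs [1 < m - 1]. *)
  have m_gt2 : (2 < m)%N.
    rewrite -[m]card_ord -[3%N]card_ord.
    apply: (@leq_card _ _ (fun i : 'I_3 => d (a + e *+ i))) => i j /eqP.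
    move: R => /forallP R; case: (ltngtP i j) => [ij|ji|/val_inj //].
      by move/forallP/(_ j)/implyP/(_ ij): (R i) => /negPf ->.
    by move/forallP/(_ i)/implyP/(_ ji): (R j); rewrite eq_sym => /negPf ->.
  have [|c [cex cun _]] := merge_colors (m := m.-1) dex dun; first by lia.
  have /negP : ~~ forces_rainbow H 3 m.-1.
    by apply/negP => /m_min; lia.
  rewrite /forces_rainbow => /negP; rewrite negb_and => /orP[/negP[]|].
    by apply/existsP; exists c; rewrite cex.
  case/forallPn => c'; rewrite negb_imply => /andP[/andP[ex' /unitaryP u']].
  by move=> /rainbow_freeP free'; exists c'.
rewrite (eqP mP) /=.
have -> : #|H| = #|[set id x | x : H]|.
  by rewrite card_imset.
apply: (@free_colorable_image _ _ id 0) => //.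
by apply/rainbow_freeP; move: AP; rewrite /has_AP => ->.
Qed.

Lemma free_colorable_gt0 (H : finZmodType) r : free_colorable H r -> (0 < r)%N.
Proof. by case=> c _; apply: leq_ltn_trans (ltn_ord (c 0)). Qed.

Lemma free_colorable0 (H : finZmodType) r : free_colorable H r ->
  exists c : {ffun H -> 'I_r},
    [/\ exact c, uniquely_colored c 0 & rainbow_free c].
Proof.
case=> c [ex [x0 u0] free]; exists [ffun x => c (x + x0)]; split.
- apply/forallP => i; have /existsP[x /eqP <-] := forallP ex i.
  by apply/existsP; exists (x - x0); rewrite ffunE subrK.
- by move=> y; rewrite !ffunE add0r => /u0 /(canRL (addrK x0)); rewrite subrr.
move=> x y z xz; rewrite !ffunE; apply: free.
by rewrite !addrA -[x + x0 + z]addrAC -[y + x0 + y]addrAC xz.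
Qed.

(** * Lower bound for the product *)

Lemma aw_u_prod_geq (G K : finZmodType) (r s : nat) :
  injective (fun x : K => x + x) ->
  free_colorable G r -> free_colorable K s ->
  (r + s <= aw_u (G * K)%type 3)%N.
Proof.
move=> dbl_inj [c [cex [g0 ug] cfree]] [d [dex [k0 uk] dfree]].
pose f (x : G * K) : 'I_r + 'I_s :=
  if x.2 == k0 then inl (c x.1) else inr (d x.2).
have u : uniquely_colored f (g0, k0).
  case=> g k; rewrite /f /= eqxx; case: eqP => // -> [] /ug -> //.
have free : rainbow_free f.
  move=> [g i] [h j] [l k] [gl ik]; rewrite /f /=.
  (* Two indices equal to [k0] force the third. If exactly one equals [k0], its color under [d] is
     unique, so the other two share theirs. *)
  case: (i =P k0) ik => [->|ni]; case: (j =P k0) => [->|nj];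
    case: (k =P k0) => [->|nk] ik.
  - by case: (cfree _ _ _ gl) => [->|[->|->]]; [left|right; left|right; right].
  - by case: nk; apply: (addrI k0).
  - by case: nj; apply: dbl_inj.
  - case: (dfree _ _ _ ik) => [/esym/uk //|[->|/esym/uk //]].
    by right; left.
  - by case: ni; apply: (addIr k0).
  - case: (dfree _ _ _ ik) => [/uk //|[/esym/uk //|->]].
    by right; right.
  - by case: (dfree _ _ _ ik) => [->|[/uk //|/uk //]]; left.
  - by case: (dfree _ _ _ ik) => [->|[->|->]]; [left|right; left|right; right].
have card_lt := free_colorable_lt_aw_u (free_colorable_image u free).
(* Only [d k0] is lost, as its single fibre is recolored by [c]: [r + s - 1] colors remain. *)
have sub : [set~ inr (d k0)] \subset [set f x | x : G * K].
  apply/subsetP => -[i|i]; rewrite !inE => ni.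
    have /existsP[g /eqP <-] := forallP cex i.
    by apply/imsetP; exists (g, k0); rewrite // /f eqxx.
  have /existsP[k /eqP ki] := forallP dex i.
  apply/imsetP; exists (0, k); rewrite // /f /= ki.
  by case: (k =P k0) ki ni => [-> <-|//]; rewrite eqxx.
have := leq_ltn_trans (subset_leq_card sub) card_lt.
by rewrite cardsC1 card_sum !card_ord; case: (r + s)%N.
Qed.

(** * Upper bound: symmetries of a coloring with unique color at [0] *)

Section UpperBound.

Variables (G K : finZmodType) (C : finType) (c : G * K -> C).
Hypothesis dbl_inj : injective (fun x : K => x + x).
Hypothesis c_unique0 : uniquely_colored c 0.
Hypothesis c_free : rainbow_free c.

(** The progression [x, 0, - x] has the unique color in its middle. *)
Lemma color_opp x : c (- x) = c x.
Proof.
case: (c_free (x := x) (y := 0) (z := - x)) => [|/c_unique0 ->|].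
- by rewrite subrr addr0.
- by rewrite oppr0.
by case=> [/esym/c_unique0 e|//]; rewrite -[x in RHS]opprK e oppr0.
Qed.

(** The progression [0, x, x + x] starts with the unique color. *)
Lemma color_dbl x : x + x != 0 -> c (x + x) = c x.
Proof.
move=> nx; case: (c_free (x := 0) (y := x) (z := x + x)) => [|e|].
- by rewrite add0r.
- by move: nx; rewrite (c_unique0 (esym e)) addr0 eqxx.
by case=> [//|/esym/c_unique0 e]; rewrite e eqxx in nx.
Qed.

(** * Colors absent from the zero fibre, and the coloring of [K] they induce *)

Definition base_colors : {set C} := [set c (g, 0) | g : G].

Definition new_color (i : K) (b : C) : bool :=
  (b \notin base_colors) && [exists g, c (g, i) == b].

Lemma new_colorP i b :
  reflect (b \notin base_colors /\ exists g, c (g, i) = b) (new_color i b).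
Proof.
apply: (iffP andP) => -[nb].
  by move=> /existsP[g /eqP e]; split=> //; exists g.
by move=> [g e]; split=> //; apply/existsP; exists g; apply/eqP.
Qed.

Lemma base_color g : c (g, 0) \in base_colors.
Proof. exact: imset_f. Qed.

Lemma new_color_neq0 i b : new_color i b -> i != 0.
Proof.
by case/new_colorP=> nb [g e]; apply: contraNneq nb => i0; rewrite -e i0 base_color.
Qed.

(** Injectivity of doubling gives [i + i != 0], whatever the torsion of [g]. *)
Lemma color_dbl_fibre g i : i != 0 -> c (g + g, i + i) = c (g, i).
Proof.
move=> ni; rewrite -[RHS]color_dbl //.
by apply: contra_neq ni => -[_ e]; apply: dbl_inj; rewrite e addr0.
Qed.

Lemma new_color_dbl i b : new_color i b -> new_color (i + i) b.
Proof.
move=> ib; have ni := new_color_neq0 ib.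
case/new_colorP: ib => nb [g e]; apply/new_colorP; split=> //.
by exists (g + g); rewrite color_dbl_fibre.
Qed.

(** Doubling maps the finite set of fibres carrying [b] injectively into itself, hence onto itself.
    This avoids halving in [G]. *)
Lemma new_color_half i b : new_color (i + i) b -> new_color i b.
Proof.
pose A := [set i | new_color i b].
have /eqP eA : (fun x : K => x + x) @: A == A.
  rewrite eqEcard card_imset // leqnn andbT.
  by apply/subsetP => _ /imsetP[j jA ->]; move: jA; rewrite !inE; apply: new_color_dbl.
move=> ib; have : i + i \in A by rewrite inE.
by rewrite -eA => /imsetP[j jA /dbl_inj ->]; rewrite inE in jA.
Qed.

Lemma new_color_opp i b : new_color i b -> new_color (- i) b.
Proof.
case/new_colorP=> nb [g e]; apply/new_colorP; split=> //.
by exists (- g); rewrite -e -[RHS]color_opp.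
Qed.

Lemma new_color_uniq i b b' : new_color i b -> new_color i b' -> b = b'.
Proof.
move=> ib; have ni := new_color_neq0 ib.
case/new_colorP: ib => nb [g eb] /new_colorP[nb' [h eb']].
have [] := c_free (x := (h + h - (g + g), 0)) (y := (h, i)) (z := (g + g, i + i)).
- by congr pair; rewrite ?subrK ?add0r.
- by move=> e; rewrite -eb' -e base_color in nb'.
rewrite color_dbl_fibre // eb eb'; case=> [//|e].
by rewrite -e base_color in nb.
Qed.

(** Witnesses of [b] and [b'] extend to a progression whose last term must repeat one of these
    colors. *)
Lemma new_color_end i j k b b' : i + k = j + j -> b != b' ->
  new_color i b -> new_color j b' -> new_color k b \/ new_color k b'.
Proof.
move=> ik /eqP bb' /new_colorP[nb [g eb]] /new_colorP[nb' [h eb']].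
have [] := c_free (x := (g, i)) (y := (h, j)) (z := (h + h - g, k)).
- by congr pair; rewrite ?ik // addrC subrK.
- by rewrite eb eb'.
rewrite eb eb'; case=> e; [right|left]; apply/new_colorP; split=> //;
  by exists (h + h - g).
Qed.

(* Midpoints need not exist in [G], so the endpoints are doubled first. *)
Lemma new_color_mid i j k b b' : i + k = j + j -> b != b' ->
  new_color i b -> new_color k b' -> new_color j b \/ new_color j b'.
Proof.
move=> ik /eqP bb' ib kb'.
have ni := new_color_neq0 ib; have nk := new_color_neq0 kb'.
case/new_colorP: ib => nb [g eb]; case/new_colorP: kb' => nb' [h eb'].
have [] := c_free (x := (g + g, i + i)) (y := (g + h, j + j)) (z := (h + h, k + k)).
- by congr pair; rewrite -?ik /= addrACA.
- rewrite color_dbl_fibre // eb => e; left.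
  by apply/new_color_half/new_colorP; split=> //; exists (g + h).
rewrite !color_dbl_fibre // eb eb'; case=> // e; right.
by apply/new_color_half/new_colorP; split=> //; exists (g + h).
Qed.

(* [None] colors the nonzero fibres without new color. *)
Definition quotient_coloring (i : K) : option C :=
  if i == 0 then Some (c 0) else [pick b | new_color i b].

Lemma quotient_coloring_new i b : new_color i b -> quotient_coloring i = Some b.
Proof.
move=> ib; rewrite /quotient_coloring (negPf (new_color_neq0 ib)).
by case: pickP => [b' /(new_color_uniq ib) -> //|/(_ b)]; rewrite ib.
Qed.

Lemma quotient_coloring_ext i j : i != 0 -> j != 0 ->
  (forall b, new_color i b = new_color j b) ->
  quotient_coloring i = quotient_coloring j.
Proof.
move=> /negPf ni /negPf nj e; rewrite /quotient_coloring ni nj.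
exact: eq_pick.
Qed.

Lemma quotient_coloring_dbl i : i != 0 ->
  quotient_coloring (i + i) = quotient_coloring i.
Proof.
move=> ni; apply: quotient_coloring_ext => // [|b].
  by apply: contra_neq ni => e; apply: dbl_inj; rewrite e addr0.
by apply/idP/idP; [apply: new_color_half | apply: new_color_dbl].
Qed.

Lemma quotient_coloring_opp i : quotient_coloring (- i) = quotient_coloring i.
Proof.
have [->|ni] := eqVneq i 0; first by rewrite oppr0.
apply: quotient_coloring_ext; rewrite ?oppr_eq0 // => b.
apply/idP/idP; last exact: new_color_opp.
by move=> /new_color_opp; rewrite opprK.
Qed.

(** The color [c 0] occurs on the zero fibre, so it is never picked as a new color. *)
Lemma quotient_coloring_unique : uniquely_colored quotient_coloring 0.
Proof.
move=> i; rewrite /quotient_coloring eqxx; case: eqP => // _.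
case: pickP => // b /andP[nb _] [e].
by move: nb; rewrite e (base_color 0).
Qed.

(** A zero term reduces the claim to invariance under negation or doubling. Otherwise two distinct
    new colors force one of them on the third fibre. *)
Lemma quotient_coloring_free : rainbow_free quotient_coloring.
Proof.
move=> x y z xz.
have [y0|ny] := eqVneq y 0.
  right; right; rewrite -quotient_coloring_opp; congr quotient_coloring.
  by apply/eqP; rewrite eq_sym -addr_eq0 addrC xz y0 addr0.
have [x0|nx] := eqVneq x 0.
  right; left; rewrite -quotient_coloring_dbl //; congr quotient_coloring.
  by rewrite -xz x0 add0r.
have [z0|nz] := eqVneq z 0.
  left; rewrite -[RHS]quotient_coloring_dbl //; congr quotient_coloring.
  by rewrite -xz z0 addr0.
have qP i : i != 0 ->
    (exists2 b, new_color i b & quotient_coloring i = Some b) \/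
    quotient_coloring i = None.
  rewrite /quotient_coloring => /negPf ->.
  by case: pickP => [b ib|_]; [left; exists b | right].
(* The reversed progression serves the case where [x] has no new color. *)
have zx : z + x = y + y by rewrite addrC.
case: (qP x nx) => [[b xb qx]|qx]; case: (qP y ny) => [[b' yb' qy]|qy].
- have [e|nb] := eqVneq b b'; first by left; rewrite qx qy e.
  case: (new_color_end xz nb xb yb') => /quotient_coloring_new ->.
    by right; right.
  by right; left.
- case: (qP z nz) => [[b' zb' qz]|->]; last by right; left.
  have [e|nb] := eqVneq b b'; first by right; right; rewrite qx qz e.
  case: (new_color_mid xz nb xb zb') => /quotient_coloring_new ->.
    by left.
  by right; left.
- case: (qP z nz) => [[b zb qz]|->]; last by right; right.
  have [e|nb] := eqVneq b b'; first by right; left; rewrite qy qz e.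
  case: (new_color_end zx nb zb yb') => /quotient_coloring_new ->.
    by right; right.
  by left.
by left; rewrite qx qy.
Qed.

(** * Counting base and new colors *)

Lemma base_coloring_unique : uniquely_colored (fun g => c (g, 0)) 0.
Proof. by move=> g /c_unique0 []. Qed.

Lemma base_coloring_free : rainbow_free (fun g => c (g, 0)).
Proof. by move=> x y z e; apply: c_free; congr pair. Qed.

Hypothesis c_onto : forall b, exists x, c x = b.

(** There are at most [aw_u G 3 - 1] base colors. The new colors together with [c 0] number at most
    [aw_u K 3 - 1]. *)
Lemma card_colors_lt_aw_u : (#|C| < aw_u G 3 + aw_u K 3 - 2)%N.
Proof.
have := free_colorable_lt_aw_u
  (free_colorable_image base_coloring_unique base_coloring_free).
have := free_colorable_lt_aw_u
  (free_colorable_image quotient_coloring_unique quotient_coloring_free).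
rewrite -/base_colors; set Q := [set _ | _ : K].
have sub : Some (c 0) |: [set Some b | b in ~: base_colors] \subset Q.
  apply/subsetP => o /setU1P[->|/imsetP[b nb ->]].
    by apply/imsetP; exists 0; rewrite // /quotient_coloring eqxx.
  rewrite inE in nb; have [[g i] e] := c_onto b.
  apply/imsetP; exists i => //; apply/esym/quotient_coloring_new/new_colorP.
  by split=> //; exists g.
have := subset_leq_card sub; rewrite cardsU1 card_imset; last exact: Some_inj.
have -> : Some (c 0) \notin [set Some b | b in ~: base_colors].
  apply/imsetP => -[b nb [e]]; move: nb.
  by rewrite inE -e (base_color 0).
have := cardsC base_colors; lia.
Qed.

End UpperBound.

(** * The product formula and odd cyclic groups *)

Lemma aw_u_prod (G K : finZmodType) :
  injective (fun x : K => x + x) ->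
  aw_u (G * K)%type 3 = (aw_u G 3 + aw_u K 3 - 2)%N.
Proof.
move=> dbl_inj.
have aG := free_colorable_aw_u G; have aK := free_colorable_aw_u K.
(* Positivity makes the truncated predecessors and subtraction exact. *)
have gG := free_colorable_gt0 aG; have gK := free_colorable_gt0 aK.
have lower := aw_u_prod_geq dbl_inj aG aK.
have [c [/forallP ex u free]] := free_colorable0 (free_colorable_aw_u (G * K)%type).
have onto b : exists x, c x = b.
  by have /existsP[x /eqP <-] := ex b; exists x.
have := card_colors_lt_aw_u dbl_inj u free onto; rewrite card_ord; lia.
Qed.

(** Multiplication by [(n + 2) / 2] undoes doubling, since [n + 2] is [1] modulo [n + 1]. *)
Lemma ord_dbl_inj (n : nat) : odd n.+1 -> injective (fun x : 'I_n.+1 => x + x).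
Proof.
move=> n_odd; apply: (can_inj (g := fun x => x *+ n.+2./2)) => x.
rewrite -mulr2n -mulrnA mul2n.
rewrite even_halfK; last by rewrite oddS n_odd.
by rewrite mulrS Zp_mulrn /= -[RHS]addr0; congr (_ + _); apply/val_inj; rewrite /= modnMl.
Qed.

(* 'I_n.-1.+1 is the additive group Z/n for every n > 0, whereas 'Z_1 is Z/2. *)
Theorem theorem14 (G : finZmodType) (n : nat) (n_gt0 : (0 < n)%N)
    (n_odd : odd n) :
  aw_u (G * 'I_n.-1.+1)%type 3 = (aw_u G 3 + aw_u 'I_n.-1.+1 3 - 2)%N.
Proof. by apply/aw_u_prod/ord_dbl_inj; rewrite prednK. Qed.
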